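(* Let $p,q,a,b,c,d\in\mathbb F_2$. The algebra $S(p,q,a,b,c,d)$ is endo-commutative if and only if it is equal to one of $S_1,S_2,\dots,S_{13}$ (that is, if and only if $(p,q,a,b,c,d)$ is one of the thirteen corresponding parameter tuples), where $S_1=S(0,0,0,0,0,1)$, $S_2=S(0,0,0,1,0,0)$, $S_3=S(0,1,1,1,1,0)$, $S_4=S(0,1,1,0,1,1)$, $S_5=S(1,1,1,0,1,0)$, $S_6=S(1,0,0,0,0,0)$, $S_7=S(1,0,1,1,1,1)$, $S_8=S(0,0,0,0,0,0)$, $S_9=S(0,0,0,1,0,1)$, $S_{10}=S(0,1,0,1,0,1)$, $S_{11}=S(0,1,1,0,1,0)$, $S_{12}=S(1,0,0,1,1,0)$, $S_{13}=S(1,0,1,0,0,1)$.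
   Context: An algebra over the two-element field $\mathbb F_2$ is an $\mathbb F_2$-vector space with a bilinear multiplication, not assumed associative, commutative or unital. An algebra $A$ is endo-commutative if $x^2y^2=(xy)^2$ for all $x,y\in A$. For $p,q,a,b,c,d\in\mathbb F_2$, $S(p,q,a,b,c,d)$ denotes the two-dimensional algebra over $\mathbb F_2$ with linear base $\{e,f\}$ and $e^2=f$, $f^2=pe+qf$, $ef=ae+bf$, $fe=ce+df$. *)

(* Defs.v *)
From HB Require Import structures.
From mathcomp Require Import all_boot all_order all_algebra.
From mathcomp Require Import ring.

Set Implicit Arguments.
Unset Strict Implicit.
Unset Printing Implicit Defensive.

Import GRing.Theory.

Local Open Scope ring_scope.

(* An algebra over F_2 is an F_2-vector space V together with a bilinear      *)
(* multiplication m; nothing else is assumed of m.                            *)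
Definition endo_commutative (V : lmodType 'F_2) (m : {bilinear V -> V -> V}) :=
  forall x y : V, m (m x x) (m y y) = m (m x y) (m x y).

Definition vec_e : 'rV['F_2]_2 := delta_mx 0 0.
Definition vec_f : 'rV['F_2]_2 := delta_mx 0 1.

(* The bilinear extension of e^2 = f, ef = ae + bf, fe = ce + df and          *)
(* f^2 = pe + qf, where e = vec_e and f = vec_f; x 0 0 and x 0 1 are the      *)
(* coordinates of x in the base {e, f}.                                       *)
Definition S_mul (p q a b c d : 'F_2) (x y : 'rV['F_2]_2) : 'rV['F_2]_2 :=
    (x 0 0 * y 0 0) *: vec_f
  + (x 0 0 * y 0 1) *: (a *: vec_e + b *: vec_f)
  + (x 0 1 * y 0 0) *: (c *: vec_e + d *: vec_f)
  + (x 0 1 * y 0 1) *: (p *: vec_e + q *: vec_f).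

Lemma S_is_bilinear p q a b c d : bilinear_for *:%R *:%R (S_mul p q a b c d).
Proof.
by split=> u k x y; apply/rowP=> i; rewrite !mxE; ring.
Qed.

HB.instance Definition _ p q a b c d :=
  bilinear_isBilinear.Build 'F_2 'rV['F_2]_2 'rV['F_2]_2 'rV['F_2]_2
    *:%R *:%R (S_mul p q a b c d) (S_is_bilinear p q a b c d).

Definition alg_S p q a b c d :
  {bilinear 'rV['F_2]_2 -> 'rV['F_2]_2 -> 'rV['F_2]_2} := S_mul p q a b c d.

Lemma ef_coord (x : 'rV['F_2]_2) (s t : 'F_2) :
  x = s *: vec_e + t *: vec_f <-> s = x 0 0 /\ t = x 0 1.
Proof.
split=> [-> | [-> ->]]; first by rewrite !mxE /= !mulr1 !mulr0 addr0 add0r.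
apply/rowP=> i; rewrite !mxE /=.
by case: i => [[|[|//]] ilt] /=; rewrite !(mulr1, mulr0, addr0, add0r);
  congr (x _ _); apply/val_inj.
Qed.

Lemma S_table p q a b c d (m := alg_S p q a b c d) :
  [/\ m vec_e vec_e = vec_f, m vec_f vec_f = p *: vec_e + q *: vec_f,
      m vec_e vec_f = a *: vec_e + b *: vec_f &
      m vec_f vec_e = c *: vec_e + d *: vec_f].
Proof.
by split; rewrite /m /= /S_mul !mxE /=
  ?(mulr0, mul0r, mulr1, scale0r, scale1r, addr0, add0r).
Qed.

(* The parameters (p, q, a, b, c, d) of S_1, ..., S_13, in this order.        *)
Definition S_params : seq ('F_2 * 'F_2 * 'F_2 * 'F_2 * 'F_2 * 'F_2) :=
  [:: (0, 0, 0, 0, 0, 1);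
      (0, 0, 0, 1, 0, 0);
      (0, 1, 1, 1, 1, 0);
      (0, 1, 1, 0, 1, 1);
      (1, 1, 1, 0, 1, 0);
      (1, 0, 0, 0, 0, 0);
      (1, 0, 1, 1, 1, 1);
      (0, 0, 0, 0, 0, 0);
      (0, 0, 0, 1, 0, 1);
      (0, 1, 0, 1, 0, 1);
      (0, 1, 1, 0, 1, 0);
      (1, 0, 0, 1, 1, 0);
      (1, 0, 1, 0, 0, 1)].

(* Ordinals start at 0: S_list i is S_(i+1).                                  *)
Definition S_list (i : 'I_13) :
  {bilinear 'rV['F_2]_2 -> 'rV['F_2]_2 -> 'rV['F_2]_2} :=
  let: (p, q, a, b, c, d) := nth (0, 0, 0, 0, 0, 0) S_params i in
  alg_S p q a b c d.

(* Main.v *)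
Require Import Defs.
From mathcomp Require Import all_boot all_order all_algebra.

(** Over F_2 everything is finite: there are 64 parameter tuples and 16 pairs of
    vectors, so the equivalence of endo-commutativity with membership in the
    list is a matter of computation, done on coordinates in the base {e, f}.
    The computation can be kept short, because two pairs of vectors already
    decide the matter.  Put g = e + f.  The identities
      e^2 g^2 = (e g)^2   and   g^2 e^2 = (g e)^2
    are four polynomial equations in p, q, a, b, c, d, and they have exactly the
    thirteen listed solutions ([S_params_of_ec]).  Conversely each of the
    thirteen algebras satisfies x^2 y^2 = (x y)^2 for all sixteen pairs
    ([ec_of_S_params]).

    The version with equality of algebras then needs no argument separating
    the multiplications of different tuples: if S(p, q, a, b, c, d) equals some
    S_i, it is endo-commutative because S_i is. *)

Import GRing.Theory.

Local Open Scope ring_scope.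

(** The multiplication of S(p, q, a, b, c, d) on coordinate pairs.  Unlike
    row vectors, which are built by an opaque function, pairs compute. *)
Definition coord_mul (p q a b c d : 'F_2) (x y : 'F_2 * 'F_2) : 'F_2 * 'F_2 :=
  (x.1 * y.2 * a + x.2 * y.1 * c + x.2 * y.2 * p,
   x.1 * y.1 + x.1 * y.2 * b + x.2 * y.1 * d + x.2 * y.2 * q).

Definition coord_ec_at (p q a b c d : 'F_2) (x y : 'F_2 * 'F_2) : bool :=
  let m := coord_mul p q a b c d in m (m x x) (m y y) == m (m x y) (m x y).

Definition coords (x : 'rV['F_2]_2) : 'F_2 * 'F_2 := (x 0 0, x 0 1).

Lemma coords_inj : injective coords.
Proof.
move=> x y [xy0 xy1].
have /ef_coord -> : x 0 0 = x 0 0 /\ x 0 1 = x 0 1 by [].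
by apply/esym/ef_coord; rewrite xy0 xy1.
Qed.

Lemma coords_surj s : exists x, coords x = s.
Proof.
exists (s.1 *: vec_e + s.2 *: vec_f); case: s => s t /=.
have [] := (ef_coord (s *: vec_e + t *: vec_f) s t).1 erefl.
by rewrite /coords => <- <-.
Qed.

Lemma coords_S p q a b c d x y :
  coords (alg_S p q a b c d x y) = coord_mul p q a b c d (coords x) (coords y).
Proof.
rewrite /coords /coord_mul /= /S_mul !mxE /=.
by rewrite !(mulr0, mulr1, addr0, add0r).
Qed.

Lemma ec_coordP p q a b c d :
  endo_commutative (alg_S p q a b c d) <->
  forall s t, coord_ec_at p q a b c d s t.
Proof.
split=> [ec s t | ec x y].
- have [[x <-] [y <-]] := (coords_surj s, coords_surj t).
  by rewrite /coord_ec_at -!coords_S ec.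
- by apply: coords_inj; rewrite !coords_S; apply/eqP/ec.
Qed.

(** Destructing an element of F_2 leaves ordinals carrying arbitrary bound
    proofs; with 0 and 1 in their place the cases become closed terms. *)
Lemma F2_ind (P : 'F_2 -> Prop) : P 0 -> P 1 -> forall x, P x.
Proof.
move=> P0 P1 [[|[|//]] lt_x].
- by rewrite (_ : Ordinal lt_x = 0) //; apply: val_inj.
- by rewrite (_ : Ordinal lt_x = 1) //; apply: val_inj.
Qed.

(** The pairs (e, e + f) and (e + f, e) suffice; no single pair of vectors
    does. *)
Lemma S_params_of_ec p q a b c d :
  coord_ec_at p q a b c d (1, 0) (1, 1) ->
  coord_ec_at p q a b c d (1, 1) (1, 0) ->
  (p, q, a, b, c, d) \in S_params.
Proof.
by elim/F2_ind: p; elim/F2_ind: q; elim/F2_ind: a;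
   elim/F2_ind: b; elim/F2_ind: c; elim/F2_ind: d; vm_compute.
Qed.

Lemma ec_of_S_params p q a b c d :
  (p, q, a, b, c, d) \in S_params -> endo_commutative (alg_S p q a b c d).
Proof.
move=> in_params; apply/ec_coordP=> -[s t] [u v]; move: in_params.
rewrite !inE.
do ![case/orP]; move/eqP=> [-> -> -> -> -> ->];
  by elim/F2_ind: s; elim/F2_ind: t; elim/F2_ind: u; elim/F2_ind: v;
     vm_compute.
Qed.

Lemma ec_S_params p q a b c d :
  endo_commutative (alg_S p q a b c d) <-> (p, q, a, b, c, d) \in S_params.
Proof.
split=> [/ec_coordP ec|]; last exact: ec_of_S_params.
by apply: S_params_of_ec; apply: ec.
Qed.

Lemma ec_S_list i : endo_commutative (S_list i).
Proof.
have := mem_nth (0, 0, 0, 0, 0, 0) (ltn_ord i : (i < size S_params)%N).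
rewrite /S_list; case: (nth _ _ _) => [[[[[p q] a] b] c] d].
exact: ec_of_S_params.
Qed.

Theorem proposition6 (p q a b c d : 'F_2) :
  (endo_commutative (alg_S p q a b c d) <->
     exists i : 'I_13, alg_S p q a b c d = S_list i)
  /\ (endo_commutative (alg_S p q a b c d) <->
        (p, q, a, b, c, d) \in S_params).
Proof.
split; last exact: ec_S_params.
split=> [/ec_S_params in_params | [i ->]]; last exact: ec_S_list.
have lt13 : (index (p, q, a, b, c, d) S_params < 13)%N.
  by rewrite -index_mem in in_params.
by exists (Ordinal lt13); rewrite /S_list /= nth_index.
Qed.
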